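(* Let $n>2$ be an integer and let $X, Y\in L^1$ satisfy $X\le_n^- Y$. Let $k$ be an integer with $0\le k<n-2$. If $$\mu^X_{1:(n-1-j)}=\mu^Y_{1:(n-1-j)}\quad\text{for } j=0,\ldots,k,$$ then $$(-1)^{k+1}\,\mu^X_{1:(n-2-k)}\le (-1)^{k+1}\,\mu^Y_{1:(n-2-k)}.$$
   Context: $L^1$ is the set of all real random variables with finite expectation on an atomless probability space $(\Omega,\mathscr{F},\mathbb{P})$. For $X\in L^1$ with distribution function $F_X$, the left-continuous inverse is $F_X^{-1}(p)=\inf\{x\in\mathbb{R}: F_X(x)\ge p\}$ for $p\in(0,1]$, with $F_X^{-1}(0)=\inf\{x\in\mathbb{R}:F_X(x)>0\}$. Put $F_X^{[-1]}(p)=F_X^{-1}(p)$ and recursively $F_X^{[-n]}(p)=\int_0^p F_X^{[-n+1]}(u)\,du$ for $p\in[0,1]$, $n\ge 2$. $n$-th degree inverse stochastic dominance: $X\le_n^- Y$ means $F_X^{[-n]}(p)\le F_Y^{[-n]}(p)$ for all $p\in(0,1)$. Minimum order statistics: for $k\ge 1$, $\mu^X_{1:k}=\mathbb{E}[\min\{X_1,\ldots,X_k\}]$, where $X_1,\ldots,X_k$ are independent and identically distributed with distribution function $F_X$; $\mu^Y_{1:k}$ is defined likewise from $F_Y$. *)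

(* Defs.v *)
From HB Require Import structures.
From mathcomp Require Import all_boot all_order all_algebra.
From mathcomp Require Import all_classical all_reals all_analysis.
From mathcomp Require Import measurable_realfun.

Set Implicit Arguments.
Unset Strict Implicit.
Unset Printing Implicit Defensive.

Import Order.TTheory GRing.Theory Num.Theory.
Import numFieldNormedType.Exports.

Local Open Scope classical_set_scope.
Local Open Scope ring_scope.

Definition atomless (R : realType) (d : measure_display)
    (T : measurableType d) (P : probability T R) : Prop :=
  forall A : set T, measurable A -> (0 < P A)%E ->
    exists B : set T,
      [/\ measurable B, B `<=` A, (0 < P B)%E & (P B < P A)%E].

Section inverse_dominance.
Context (R : realType) (d : measure_display) (T : measurableType d).
Context (P : probability T R).
Implicit Types X Y : {RV P >-> R}.

(* Extended-real valued: the value at 0 is -oo when X is essentially unbounded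
   below, and the value at 1 is +oo when X is essentially unbounded above. *)
Definition quantile X (p : R) : \bar R :=
  if p == 0 then ereal_inf [set x%:E | x in [set x : R | (0 < cdf X x)%E]]
  else ereal_inf [set x%:E | x in [set x : R | (p%:E <= cdf X x)%E]].

(* F_X^{[-n]} for n >= 1; the value at n = 0 is a dummy. *)
Fixpoint iter_quantile X (n : nat) (p : R) : \bar R :=
  match n with
  | 0 | 1 => quantile X p
  | m.+1 => (\int[lebesgue_measure]_(u in `[0%R, p]) iter_quantile X m u)%E
  end.

Definition inverse_dominated (n : nat) X Y : Prop :=
  forall p : R, 0 < p < 1 -> (iter_quantile X n p <= iter_quantile Y n p)%E.

End inverse_dominance.

(* Mutual independence of Z 0, ..., Z (k - 1); the later terms of the sequence
   play no role. *)
Definition mutually_independent (R : realType) (d : measure_display)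
    (T : measurableType d) (Q : probability T R) (k : nat)
    (Z : nat -> {RV Q >-> R}) : Prop :=
  forall (J : {set 'I_k}) (A : 'I_k -> set R), (forall i, measurable (A i)) ->
    Q (\bigcap_(i in [set` J]) (Z i @^-1` A i)) =
    (\prod_(i in J) Q (Z i @^-1` A i))%E.

Definition iid_copies (R : realType) (d : measure_display)
    (T : measurableType d) (P : probability T R) (X : {RV P >-> R})
    (d' : measure_display) (T' : measurableType d') (Q : probability T' R)
    (k : nat) (Z : nat -> {RV Q >-> R}) : Prop :=
  mutually_independent k Z /\
  (forall i, (i < k)%N -> forall x : R, cdf (Z i) x = cdf X x).

(* For k >= 1 the minimum of Z 0, ..., Z (k - 1). *)
Definition min_of (T : Type) (R : realType) (k : nat) (Z : nat -> T -> R)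
    (w : T) : R :=
  \big[Order.min/Z 0%N w]_(i < k) Z i w.

(* mu^X_{1:k} for k >= 1: the common value of E[min(X_1, ..., X_k)] over all
   realizations of X_1, ..., X_k on arbitrary probability spaces; it is
   well defined for X in L^1 by iid_copies_exist and min_order_meanE below. *)
Definition min_order_mean (R : realType) (d : measure_display)
    (T : measurableType d) (P : probability T R) (X : {RV P >-> R})
    (k : nat) : R :=
  get [set m : R | exists (d' : measure_display) (T' : measurableType d')
      (Q : probability T' R) (Z : nat -> {RV Q >-> R}),
      iid_copies X k Z /\ ('E_Q[min_of k (fun i => Z i : T' -> R)] = m%:E)%E].

Lemma eq_ccdf_distribution (R : realType) d (T : measurableType d)
    (P : probability T R) (X : {RV P >-> R}) d' (T' : measurableType d')
    (Q : probability T' R) (Y : {RV Q >-> R}) :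
  (forall x, ccdf X x = ccdf Y x) ->
  forall A : set R, measurable A -> distribution P X A = distribution Q Y A.
Proof.
move=> XY A mA.
pose g (k : nat) : set R := `](- k%:R)%R, +oo[%classic.
have H := @measure_unique _ R _ (@RGenOInfty.G R) g
  (@RGenOInfty.measurableE R).
apply: (H _ _ _ (distribution P X) (distribution Q Y) _ _ A mA).
- move=> _ _ [x ->] [y ->]; exists (Num.max x y).
  apply/seteqP; split=> z /=; rewrite !in_itv/= !andbT gt_max.
    by case=> -> ->.
  by move=> /andP[-> ->].
- by move=> k; exists (- k%:R).
- rewrite -subTset => x _; exists (Num.truncn `|x|).+1 => //=.
  rewrite /g set_itvE/= ltrNl (le_lt_trans (ler_norm _))// normrN.
  by rewrite truncnS_gt.
- by move=> _ [x ->]; exact: XY.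
- move=> k; apply: (@le_lt_trans _ _ 1%E); last exact: ltry.
  by apply: probability_le1; exact: measurable_itv.
Qed.

Lemma eq_cdf_distribution (R : realType) d (T : measurableType d)
    (P : probability T R) (X : {RV P >-> R}) d' (T' : measurableType d')
    (Q : probability T' R) (Y : {RV Q >-> R}) :
  (forall x, cdf X x = cdf Y x) ->
  forall A : set R, measurable A -> distribution P X A = distribution Q Y A.
Proof.
by move=> XY; apply: eq_ccdf_distribution => x; rewrite !ccdf_1_cdf XY.
Qed.

Lemma iid_copies_exist (R : realType) d (T : measurableType d)
    (P : probability T R) (X : {RV P >-> R}) (k : nat) :
  exists (d' : measure_display) (T' : measurableType d')
    (Q : probability T' R) (Z : nat -> {RV Q >-> R}), iid_copies X k Z.
Proof.
have [d' [T' [Q [Z HZ]]]] : exists d' (T' : measurableType d')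
   (Q : probability T' R) (Z : nat -> {RV Q >-> R}),
   forall A : nat -> set R, (forall i, measurable (A i)) ->
   Q (\bigcap_(i in `I_k) (Z i @^-1` A i)) =
     (\prod_(i < k) P (X @^-1` A i))%E.
  elim: k => [|k [d' [T' [Q [Z HZ]]]]].
    exists d, T, P, (fun=> X) => A mA.
    by rewrite II0 bigcap_set0 big_ord0 probability_setT.
  have mf i : (fun w : T' * T => if (i < k)%N then Z i w.1 else X w.2) \in mfun.
    rewrite inE/=; case: (i < k)%N.
      exact: (measurableT_comp (measurable_funPT (Z i)) measurable_fst).
    exact: (measurableT_comp (measurable_funPT X) measurable_snd).
  exists _, _, [the probability _ _ of (Q \x P)%E], (fun i => mfun_Sub (mf i)).
  move=> A mA; rewrite /= big_ord_recr/= -HZ//.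
  have mI : measurable (\bigcap_(i in `I_k) (Z i @^-1` A i)).
    apply: bigcap_measurableType => i _.
    by rewrite -[X in measurable X]setTI; exact: measurable_funP.
  have mX : measurable (X @^-1` A k).
    by rewrite -[X in measurable X]setTI; exact: measurable_funP.
  rewrite -product_measure1E//.
  congr (_ _); apply/seteqP; split => w/=.
    move=> h; split.
      by move=> i /= ik; move: (h i); rewrite /= ltnS (ltnW ik) ik; exact.
    by move: (h k); rewrite /= ltnSn ltnn; exact.
  move=> [h1 h2] i/=; rewrite ltnS leq_eqVlt => /orP[/eqP ->|ik].
    by rewrite ltnn.
  by rewrite ik; exact: h1.
have HJ (J : {set 'I_k}) (A : 'I_k -> set R) : (forall i, measurable (A i)) ->
    Q (\bigcap_(i in [set` J]) (Z i @^-1` A i)) =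
    (\prod_(i in J) P (X @^-1` A i))%E.
  move=> mA.
  pose B (i : nat) : set R :=
    if insub i is Some j then if j \in J then A j else setT else setT.
  have mB i : measurable (B i).
    by rewrite /B; case: insubP => // j _ _; case: ifP.
  have BE (i : 'I_k) : B i = if i \in J then A i else setT by rewrite /B valK.
  have -> : \bigcap_(i in [set` J]) (Z i @^-1` A i) =
      \bigcap_(i in `I_k) (Z i @^-1` B i).
    apply/seteqP; split=> w h i /=.
      move=> ik; rewrite (BE (Ordinal ik)); case: ifPn => // iJ.
      exact: (h (Ordinal ik)).
    by move=> iJ; move: (h i (ltn_ord i)); rewrite /= BE iJ.
  rewrite HZ// [RHS]big_mkcond/=; apply: eq_bigr => i _; rewrite BE.
  case: ifP => // _; by rewrite preimage_setT probability_setT.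
have H1 (i : 'I_k) (A : set R) : measurable A ->
    Q (Z i @^-1` A) = P (X @^-1` A).
  move=> mA; have := HJ [set i]%SET (fun=> A) (fun=> mA).
  rewrite big_set1 => <-; congr (Q _).
  apply/seteqP; split=> w /=; first by move=> ? j; rewrite /= inE => /eqP ->.
  by move=> /(_ i); apply; rewrite /= inE.
exists d', T', Q, Z; split.
  move=> J A mA; rewrite HJ//; apply: eq_bigr => i _; by rewrite H1.
by move=> i ik x; exact: (H1 (Ordinal ik) `]-oo, x]%classic).
Qed.

Lemma min_of_measurable (R : realType) d (T : measurableType d)
    (P : probability T R) (Z : nat -> {RV P >-> R}) (k : nat) :
  measurable_fun [set: T] (min_of k (fun i => Z i : T -> R)).
Proof.
rewrite /min_of.
elim: (index_enum _) => [|i r IH].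
  under eq_fun do rewrite big_nil.
  exact: measurable_funPT.
under eq_fun do rewrite big_cons/=.
exact: measurable_minr.
Qed.

Lemma ccdf_min_of (R : realType) d (T : measurableType d)
    (P : probability T R) (X : {RV P >-> R}) d' (T' : measurableType d')
    (Q : probability T' R) (Z : nat -> {RV Q >-> R}) (k : nat)
    (M : {RV Q >-> R}) :
  (0 < k)%N -> (M : T' -> R) = min_of k (fun i => Z i : T' -> R) ->
  iid_copies X k Z -> forall x, ccdf M x = (\prod_(i < k) ccdf X x)%E.
Proof.
move=> k0 ME [indep eqd] x.
have -> : ccdf M x = Q (\bigcap_(i in [set` [set: 'I_k]%SET]) (Z i @^-1` `]x, +oo[%classic)).
  rewrite /ccdf /distribution /pushforward ME; congr (Q _).
  apply/seteqP; split=> w /=; rewrite in_itv/= andbT.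
    by move=> /bigmin_gtP[_ h] i _ /=; rewrite in_itv/= andbT h.
  move=> h; apply/bigmin_gtP; split.
    have := h (Ordinal k0); rewrite /= in_itv/= andbT; apply.
    by rewrite inE.
  by move=> i _; have := h i; rewrite /= in_itv/= andbT; apply; rewrite inE.
rewrite indep//.
apply: eq_big => [i|i _]; first by rewrite inE.
have : ccdf (Z i) x = ccdf X x by rewrite !ccdf_1_cdf eqd.
by [].
Qed.

Lemma min_of_L1 (R : realType) d (T : measurableType d)
    (P : probability T R) (X : {RV P >-> R}) d' (T' : measurableType d')
    (Q : probability T' R) (Z : nat -> {RV Q >-> R}) (k : nat) :
  (0 < k)%N -> (X : T -> R) \in Lfun P 1%E -> iid_copies X k Z ->
  min_of k (fun i => Z i : T' -> R) \in Lfun Q 1%E.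
Proof.
move=> k0 XL [_ eqd].
have ZL i : (i < k)%N -> Q.-integrable setT (EFin \o Z i).
  move=> ik; have /Lfun1_integrable/integrableP[_ Xoo] := XL.
  apply/integrableP; split; first exact/measurable_EFinP.
  apply: le_lt_trans Xoo.
  have mabs : measurable_fun [set: R] (fun y : R => `|y%:E|%E).
    by apply: measurableT_comp => //.
  have := @ge0_integral_distribution _ _ _ _ _ Q (Z i) _ mabs (fun=> abse_ge0 _).
  have := @ge0_integral_distribution _ _ _ _ _ P X _ mabs (fun=> abse_ge0 _).
  rewrite /comp/= => <- <-.
  rewrite (eq_measure_integral (distribution P X))// => A mA _.
  exact: eq_cdf_distribution (eqd i ik) _ mA.
apply/Lfun1_integrable.
apply: (@le_integrable _ _ _ Q _ measurableT _ (fun w => \sum_(i < k) `|(Z i w)%:E|)%E).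
- exact/measurable_EFinP/min_of_measurable.
- move=> w _ /=; rewrite [leRHS]gee0_abs; last by apply: sume_ge0.
  rewrite sumEFin lee_fin.
  have [i ->] : exists i : 'I_k, min_of k (fun i => Z i : T' -> R) w = Z i w.
    rewrite /min_of; apply: (big_ind (fun x => exists i : 'I_k, x = Z i w))
      => [|_ _ [i ->] [j ->]|i _].
    + by exists (Ordinal k0).
    + by have [_|_] := leP (Z i w) (Z j w); [exists i|exists j].
    + by exists i.
  by rewrite (bigD1 i)//= lerDl sumr_ge0.
- apply: integrable_sum => // i _; apply: integrable_abse; exact: ZL.
Qed.

Lemma min_order_meanE (R : realType) d (T : measurableType d)
    (P : probability T R) (X : {RV P >-> R}) d' (T' : measurableType d')
    (Q : probability T' R) (Z : nat -> {RV Q >-> R}) (k : nat) :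
  (0 < k)%N -> (X : T -> R) \in Lfun P 1%E -> iid_copies X k Z ->
  ('E_Q[min_of k (fun i => Z i : T' -> R)] = (min_order_mean X k)%:E)%E.
Proof.
move=> k0 XL iidZ.
have ML := min_of_L1 k0 XL iidZ.
rewrite /min_order_mean; case: xgetP => [m _|/(_ (fine 'E_Q[min_of k (fun i => Z i : T' -> R)]))]; last first.
  case; exists d', T', Q, Z; split=> //.
  by rewrite fineK// expectation_fin_num.
move=> [d1 [T1 [Q1 [Z1 [iidZ1 <-]]]]].
have ML1 := min_of_L1 k0 XL iidZ1.
pose M : {RV Q >-> R} := mfun_Sub (mem_set (min_of_measurable Z k)).
pose M1 : {RV Q1 >-> R} := mfun_Sub (mem_set (min_of_measurable Z1 k)).
have cc x : ccdf M x = ccdf M1 x.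
  by rewrite (ccdf_min_of k0 _ iidZ)// (ccdf_min_of k0 _ iidZ1).
have c x : cdf M x = cdf M1 x by rewrite !cdf_1_ccdf cc.
have := @expectation_cdf_ccdf _ _ _ _ M ML.
have := @expectation_cdf_ccdf _ _ _ _ M1 ML1.
rewrite /= => -> ->.
by congr (_ - _)%E; apply: eq_integral => x _; rewrite ?cc ?c.
Qed.

(* Main.v *)
Require Import Defs.
From mathcomp Require Import all_boot all_order all_algebra.
From mathcomp Require Import all_classical all_reals all_analysis.
From mathcomp Require Import measurable_realfun unstable.
From mathcomp Require Import zify.
Import Order.TTheory GRing.Theory Num.Theory.
Import numFieldNormedType.Exports.
Local Open Scope classical_set_scope.
Local Open Scope ring_scope.

(** Let q_X be the quantile function of X on ]0, 1[ and J_m the m-fold iterated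
    integral from 0. Up to the shift of index, F_X^{[-n]} is J_(n-1) q_X, and
    both sides of the claim are values at the single point 1.

    Cauchy's formula for repeated integration ([iterint1]) gives
    m! J_(m+1) g (1) = \int_0^1 (1 - u)^m g(u) du. On the other side, pushing the
    law of density k (1 - u)^(k-1) on [0, 1] (that of the minimum of k uniform
    variables) forward by q_X gives the law of the minimum of k independent
    copies of X, since q_X(u) > x iff u > F_X(x), and the interval ]F_X(x), 1[
    has mass (1 - F_X(x))^k ([ccdf_beta_qRV]). Taking expectations,
    mu^X_{1:k} = k! J_k q_X (1) ([min_order_mean_iterint]).

    With g = q_Y - q_X, the hypotheses therefore say that J_(n-1) g >= 0 on
    ]0, 1[ and that J_(n-1) g, ..., J_(n-1-k) g vanish at 1. Near 1 the function
    J_(n-1) g thus behaves like the Taylor term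
    J_(n-2-k) g (1) (p - 1)^(k+1) / (k+1)!, and its nonnegativity gives
    (-1)^(k+1) J_(n-2-k) g (1) >= 0 ([iterint_sign]). In place of derivatives,
    the argument uses that J_m g is continuous at 1 for m >= 1 and that a strict
    inequality of the wrong sign propagates from 1 downwards under integration. *)

(** * Iterated integrals and their sign near 1 *)

Section iterated_integral.
Context {R : realType}.
Notation mu := (@lebesgue_measure R).
Implicit Types g h w : R -> R.

Fixpoint iterint (g : R -> R) (m : nat) : R -> R :=
  if m is m'.+1 then fun p => \int[mu]_(u in `[0, p]) iterint g m' u else g.

Lemma integrable_primitive g : mu.-integrable `[0, 1] (EFin \o g) ->
  mu.-integrable `[0, 1] (EFin \o (fun p => \int[mu]_(u in `[0, p]) g u)).
Proof.
move=> ig; apply: continuous_compact_integrable; first exact: segment_compact.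
exact: (parameterized_integral_continuous ler01 ig).
Qed.

Lemma integrable_iterint g m : mu.-integrable `[0, 1] (EFin \o g) ->
  mu.-integrable `[0, 1] (EFin \o iterint g m).
Proof. by move=> ig; elim: m => //= m; exact: integrable_primitive. Qed.

Lemma integrable_iterintS g m p : mu.-integrable `[0, 1] (EFin \o g) ->
  p <= 1 -> mu.-integrable `[0, p] (EFin \o iterint g m).
Proof.
move=> ig p1; apply: integrableS (integrable_iterint g m ig) => //.
by apply: subset_itvl; rewrite bnd_simp.
Qed.

Lemma iterintB g h m p : mu.-integrable `[0, 1] (EFin \o g) ->
  mu.-integrable `[0, 1] (EFin \o h) -> p <= 1 ->
  iterint (g \- h) m p = iterint g m p - iterint h m p.
Proof.
move=> ig ih; elim: m p => //= m IH p p1.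
rewrite -RintegralB//; try exact: integrable_iterintS.
apply: eq_Rintegral => u; rewrite inE/= in_itv/= => /andP[_ up].
by apply: IH; exact: le_trans up p1.
Qed.

Lemma Rintegral_onemXn_itv n p : p <= 1 ->
  \int[mu]_(u in `[p, 1]) ((1 - u) ^+ n) = (1 - p) ^+ n.+1 / n.+1%:R.
Proof.
rewrite le_eqVlt => /predU1P[->|p1].
  by rewrite set_itv1 Rintegral_set1 subrr expr0n/= mul0r.
rewrite /Rintegral.
rewrite (@continuous_FTC2 _ _ (fun x => onem x ^+ n.+1 / - n.+1%:R))//=.
- by rewrite onem1 expr0n/= mul0r sub0r /onem invrN mulrN opprK.
- by apply: continuous_in_subspaceT => x _; exact: continuous_onemXn.
- have c (x : R) : (onem y ^+ n.+1 / - n.+1%:R) @[y --> x] -->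
      onem x ^+ n.+1 / - n.+1%:R.
    by apply: cvgM; [exact: continuous_onemXn|exact: cvg_cst].
  split.
  + by move=> y y01; apply: derivableM => //=; exact: onemXn_derivable.
  + by apply: cvg_at_right_filter; exact: c.
  + by apply: cvg_at_left_filter; exact: c.
- move=> x x01; rewrite derive1Mr//; last exact: onemXn_derivable.
  by rewrite derive_onemXn mulrAC divff// mul1r.
Qed.

Lemma integrable_onemXn n :
  mu.-integrable `[0, 1] (EFin \o (fun u => (1 - u) ^+ n)).
Proof.
apply: continuous_compact_integrable; first exact: segment_compact.
by apply: continuous_in_subspaceT => x _; exact: continuous_onemXn.
Qed.

(** If the value at 1 had the wrong sign, continuity would give c > 0 with
    (-1)^r J_m <= - c on some [a, 1]. As J_(m+s) vanishes at 1 for 0 < s <= r,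
    one has J_(m+s) (p) = - \int_p^1 J_(m+s-1), so that by induction
    (-1)^(r-s) J_(m+s) (p) <= - c (1 - p)^s / s! there. At s = r this contradicts
    J_(m+r) (a) >= 0. The condition 0 < m provides the continuity at 1. *)
Lemma iterint_sign g m r : mu.-integrable `[0, 1] (EFin \o g) ->
  (0 < m)%N ->
  (forall i, (m < i <= m + r)%N -> iterint g i 1 = 0) ->
  (forall p, 0 < p < 1 -> 0 <= iterint g (m + r) p) ->
  0 <= (-1) ^+ r * iterint g m 1.
Proof.
move=> ig m0 J0 Jge0; rewrite leNgt; apply/negP => Jm1.
(* Half the gap leaves room for continuity. *)
pose c := - ((-1) ^+ r * iterint g m 1) / 2.
have c0 : 0 < c by rewrite divr_gt0// oppr_gt0.
have [a [a01 Jm]] : exists a, 0 < a < 1 /\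
    forall p, a <= p <= 1 -> (-1) ^+ r * iterint g m p <= - c.
  have cvgJ : (-1) ^+ r * iterint g m p @[p --> 1^'-] -->
      (-1) ^+ r * iterint g m 1.
    apply: cvgM; first exact: cvg_cst.
    case: m m0 {J0 Jge0 Jm1 c c0} => // m _.
    exact: (parameterized_integral_cvg_at_left _ (integrable_iterint g m ig)).
  have lec : (-1) ^+ r * iterint g m 1 < - c.
    by rewrite /c mulNr opprK ltr_pdivlMr// mulr_natr mulr2n gtrDl.
  have /(_ _) := cvgr_lt _ cvgJ _ lec.
  move=> [e /= e0 He].
  pose a := 1 - Num.min (e / 2) (1 / 2).
  have min0 : 0 < Num.min (e / 2) (1 / 2) :> R by rewrite lt_min !divr_gt0.
  exists a; split.
    rewrite /a subr_gt0 ltrBlDr ltrDl min0 andbT.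
    by rewrite gt_min [X in _ || X]ltr_pdivrMr// mul1r ltr1n orbT.
  move=> p /andP[ap]; rewrite le_eqVlt => /predU1P[->|p1]; first exact: ltW.
  apply/ltW/He => //=; rewrite gtr0_norm ?subr_gt0// ltrBlDr -ltrBlDl.
  apply: lt_le_trans ap; rewrite /a ltrD2l ltrN2 gt_min.
  by rewrite ltr_pdivrMr// ltr_pMr// ltr1n.
have /andP[a0 a1] := a01.
(* The quantitative bound keeps the inequality strict without appealing to
   strict monotonicity of the integral. *)
have key s p : (s <= r)%N -> a <= p <= 1 ->
    (-1) ^+ (r - s) * iterint g (m + s) p <= - (c / (s`!)%:R * (1 - p) ^+ s).
  elim: s p => [|s IH] p sr ap.
    by rewrite subn0 addn0 fact0 divr1 expr0 mulr1 Jm.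
  have /andP[lap lp1] := ap.
  have pI : mu.-integrable `[p, 1] (EFin \o iterint g (m + s)).
    apply: integrableS (integrable_iterint g (m + s) ig) => //.
    by apply: subset_itvr; rewrite bnd_simp (le_trans (ltW a0)).
  have pI' : mu.-integrable `[p, 1] (EFin \o (fun u => (1 - u) ^+ s)).
    apply: integrableS (integrable_onemXn s) => //.
    by apply: subset_itvr; rewrite bnd_simp (le_trans (ltW a0)).
  have E : iterint g (m + s.+1) p = - \int[mu]_(u in `[p, 1]) iterint g (m + s) u.
    have J1 : iterint g (m + s).+1 1 = 0.
      by apply: J0; rewrite ltnS leq_addr -addnS leq_add2l.
    rewrite addnS; apply: oppr_inj; rewrite opprK -[LHS]add0r -{1}J1 /=.
    rewrite Rintegral_itvB//; last 2 first.
      exact: integrable_iterint.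
      by rewrite bnd_simp (le_trans (ltW a0)).
    rewrite Rintegral_itv_obnd_cbnd//; apply: integrableS pI => //.
    exact: subset_itv_oc_cc.
  rewrite E mulrN lerN2.
  have -> : c / (s.+1`!)%:R * (1 - p) ^+ s.+1 =
      - \int[mu]_(u in `[p, 1]) (- (c / (s`!)%:R) * (1 - u) ^+ s).
    rewrite RintegralZl// Rintegral_onemXn_itv// mulNr opprK factS natrM invfM.
    by rewrite [RHS]mulrA [RHS]mulrAC (mulrC _^-1) !mulrA.
  rewrite lerNl -[X in X <= _]mulN1r mulrA -exprS subnSK// -RintegralZl//.
  apply: le_Rintegral => //.
  - exact: (integrableZl _ ((-1) ^+ (r - s)) pI).
  - exact: (integrableZl _ (- (c / (s`!)%:R)) pI').
  - move=> u; rewrite /= in_itv/= => /andP[pu u1].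
    rewrite mulNr; apply: IH; first exact: ltnW.
    by rewrite u1 (le_trans lap).
have := Jge0 _ a01; have := key r a (leqnn _).
rewrite lexx (ltW a1) => /(_ isT); rewrite subnn expr0 mul1r => h1 h2.
have := le_trans h2 h1; rewrite leNgt oppr_lt0 => /negP; apply.
apply: mulr_gt0; first by apply: divr_gt0 => //; rewrite ltr0n fact_gt0.
by apply: exprn_gt0; rewrite subr_gt0.
Qed.

End iterated_integral.

(** * Cauchy's formula for repeated integration *)

Section triangle.
Context {R : realType}.
Notation mu := (@lebesgue_measure R).
Implicit Types g h w : R -> R.

(** Evaluates the sections of the kernel in [Rintegral_triangle], where the
    domain D depends on the other variable but has to be put inside the
    integrand before Fubini's theorem applies. *)
Lemma integral_patchZ (D : set R) (c : R) h : measurable D ->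
  mu.-integrable D (EFin \o h) ->
  (\int[mu]_x (((fun x => c * h x) \_ D) x)%:E)%E
    = (c * \int[mu]_(x in D) h x)%:E.
Proof.
move=> mD ih; rewrite -RintegralZl// /Rintegral fineK; last first.
  by apply: integrable_fin_num => //; exact: (integrableZl _ c ih).
rewrite [RHS]integral_mkcond; apply: eq_integral => x _.
by rewrite !patchE; case: ifP.
Qed.

(** Fubini's theorem on the triangle u <= v for the kernel g(u) w(v). It plays
    the role of integration by parts for merely integrable g and w. *)
Lemma Rintegral_triangle g w : mu.-integrable `[0, 1] (EFin \o g) ->
  mu.-integrable `[0, 1] (EFin \o w) ->
  \int[mu]_(v in `[0, 1]) (w v * \int[mu]_(u in `[0, v]) g u) =
  \int[mu]_(u in `[0, 1]) (g u * \int[mu]_(v in `[u, 1]) w v).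
Proof.
move=> ig iw.
pose g1 := g \_ `[0, 1]; pose w1 := w \_ `[0, 1].
have ig1 : mu.-integrable setT (EFin \o g1).
  by rewrite -restrict_EFin; apply/integrable_restrict => //; rewrite setTI.
have iw1 : mu.-integrable setT (EFin \o w1).
  by rewrite -restrict_EFin; apply/integrable_restrict => //; rewrite setTI.
pose GR := measurableTypeR R.
have mg1 : measurable_fun setT (g1 : GR -> R).
  by apply/measurable_EFinP; exact: measurable_int ig1.
have mw1 : measurable_fun setT (w1 : GR -> R).
  by apply/measurable_EFinP; exact: measurable_int iw1.
pose f0 (z : GR * GR) : \bar R := (g1 z.1 * w1 z.2)%:E.
have mf0 : measurable_fun setT f0.
  apply/measurable_EFinP; apply: measurable_funM.
    exact: (measurableT_comp mg1 measurable_fst).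
  exact: (measurableT_comp mw1 measurable_snd).
have if0 : (mu \x mu)%E.-integrable setT f0.
  apply/integrable12ltyP => //.
  under eq_integral => u _.
    under eq_integral do rewrite /f0/= normrM EFinM.
    rewrite ge0_integralZl//; last first.
      by apply/measurable_EFinP; apply: measurableT_comp.
    over.
  have [_ fw] := integrableP _ _ _ iw1.
  have [_ fg] := integrableP _ _ _ ig1.
  rewrite ge0_integralZr//=.
  - apply: lte_mul_pinfty => //; first exact: integral_ge0.
    by rewrite ge0_fin_numE//; exact: integral_ge0.
  - by apply/measurable_EFinP; apply: measurableT_comp.
  - exact: integral_ge0.
pose f (z : GR * GR) : \bar R := (if z.1 <= z.2 then g1 z.1 * w1 z.2 else 0)%:E.
have mf : measurable_fun setT f.
  apply/measurable_EFinP; apply: measurable_fun_ifT => //.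
    exact: measurable_fun_ler.
  exact/measurable_EFinP.
have iF : (mu \x mu)%E.-integrable setT f.
  apply: le_integrable if0 => // z _; rewrite /f /f0.
  by case: ifP => // _; rewrite /= normr0 lee_fin.
have fv u : (\int[mu]_v f (u, v))%E =
    (((fun u => g u * \int[mu]_(v in `[u, 1]) w v) \_ `[0, 1]) u)%:E.
  rewrite patchE; case: ifPn => u01; last first.
    rewrite (eq_integral (cst 0%E)) ?integral0// => v _.
    by rewrite /f /g1 /= patchE (negbTE u01) mul0r if_same.
  move: (u01); rewrite inE/= in_itv/= => /andP[u0 u1].
  rewrite -integral_patchZ//; last first.
    by apply: integrableS iw => //; apply: subset_itvr; rewrite bnd_simp.
  apply: eq_integral => v _; rewrite /f /g1 /w1 /= !patchE u01.
  rewrite !mem_setE !in_itv/=; have [uv|uv]//= := leP u v.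
  by rewrite (le_trans u0 uv)/=; case: (v <= 1); rewrite ?mulr0.
have fu v : (\int[mu]_u f (u, v))%E =
    (((fun v => w v * \int[mu]_(u in `[0, v]) g u) \_ `[0, 1]) v)%:E.
  rewrite patchE; case: ifPn => v01; last first.
    rewrite (eq_integral (cst 0%E)) ?integral0// => u _.
    by rewrite /f /w1 /= patchE (negbTE v01) mulr0 if_same.
  move: (v01); rewrite inE/= in_itv/= => /andP[v0 v1].
  rewrite -integral_patchZ//; last first.
    by apply: integrableS ig => //; apply: subset_itvl; rewrite bnd_simp.
  apply: eq_integral => u _; rewrite /f /g1 /w1 /= !patchE v01.
  rewrite !mem_setE !in_itv/= [w v * _]mulrC.
  have [uv|uv]//= := leP u v; last by rewrite andbF.
  by rewrite (le_trans uv v1) andbT; case: (0 <= u); rewrite ?mul0r.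
have := Fubini iF.
under eq_integral do rewrite fv.
under [X in _ = X]eq_integral do rewrite fu.
by move=> E; rewrite [RHS]Rintegral_mkcond [LHS]Rintegral_mkcond /Rintegral E.
Qed.

Lemma integrable_onemXnM g i : mu.-integrable `[0, 1] (EFin \o g) ->
  mu.-integrable `[0, 1] (EFin \o (fun u => (1 - u) ^+ i * g u)).
Proof.
move=> ig; apply: (le_integrable _ _ _ ig) => //=.
- apply/measurable_EFinP; apply: measurable_funM.
    by apply/measurable_EFinP; exact: (measurable_int _ (integrable_onemXn i)).
  by apply/measurable_EFinP; exact: (measurable_int _ ig).
- move=> u; rewrite /= in_itv/= => /andP[u0 u1].
  have u'0 : 0 <= 1 - u by rewrite subr_ge0.
  rewrite lee_fin normrM ger0_norm ?exprn_ge0// ler_piMl//.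
  by rewrite exprn_ile1// gerBl.
Qed.

(** The quantity (i!)^-1 \int (1 - v)^i J_m g(v) dv depends on i + m only: each
    application of [Rintegral_triangle] moves one integration from the iterated
    integral to the weight. *)
Lemma Rintegral_onemXn_iterint g i m : mu.-integrable `[0, 1] (EFin \o g) ->
  (i`!)%:R^-1 * \int[mu]_(v in `[0, 1]) ((1 - v) ^+ i * iterint g m v) =
  ((i + m)`!)%:R^-1 * \int[mu]_(u in `[0, 1]) ((1 - u) ^+ (i + m) * g u).
Proof.
move=> ig; elim: m i => [|m IH] i; first by rewrite addn0.
rewrite addnS -addSn -IH /=.
rewrite Rintegral_triangle//; [|exact: integrable_iterint|exact: integrable_onemXn].
under eq_Rintegral => u.
  rewrite inE/= in_itv/= => /andP[_ u1].
  rewrite Rintegral_onemXn_itv// mulrA [_ * (1 - u) ^+ _]mulrC.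
  over.
rewrite /= RintegralZr//; last exact: integrable_onemXnM (integrable_iterint _ _ ig).
by rewrite mulrC -mulrA -invfM -natrM -factS mulrC.
Qed.

Lemma iterint1 g m : mu.-integrable `[0, 1] (EFin \o g) ->
  (m`!)%:R * iterint g m.+1 1 = \int[mu]_(u in `[0, 1]) ((1 - u) ^+ m * g u).
Proof.
move=> ig; have := Rintegral_onemXn_iterint g 0 m ig.
rewrite add0n fact0 invr1 mul1r => E.
apply: (canLR (mulVKf _)); first by rewrite pnatr_eq0 -lt0n fact_gt0.
rewrite -E /=.
by apply: eq_Rintegral => u _; rewrite expr0 mul1r.
Qed.

End triangle.

(** * The quantile function on the open unit interval *)

Section quantile_function.
Context {R : realType} {d : measure_display} {T : measurableType d}.
Context {P : probability T R}.
Implicit Types X : {RV P >-> R}.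
Notation mu := (@lebesgue_measure R).

(** The Galois connection between the quantile and distribution functions.
    Right-continuity of the latter makes the infimum attained. *)
Lemma quantile_le X u x : 0 < u ->
  (quantile X u <= x%:E)%E = (u%:E <= cdf X x)%E.
Proof.
move=> u0; rewrite /quantile gt_eqF//; apply/idP/idP => [|uF]; last first.
  by apply: ereal_inf_lbound; exists x.
apply: contraTT; rewrite -!ltNge => Fu.
have /cdf_right_continuous[e /= e0 He] : nbhs (cdf X x) [set y | (y < u%:E)%E].
  by apply: open_nbhs_nbhs; split => //; exact: open_ereal_lt_ereal.
apply: (@lt_le_trans _ _ (x + e)%:E); first by rewrite lte_fin ltrDl.
apply/ereal_infP => _ [y /= uFy <-]; rewrite lee_fin leNgt; apply/negP => yxe.
have [yx|xy] := leP y x.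
  by have := le_lt_trans (le_trans uFy (cdf_nondecreasing X yx)) Fu; rewrite ltxx.
have : (cdf X y < u%:E)%E.
  by apply: He => //=; rewrite ltr0_norm ?subr_lt0// opprB ltrBlDl.
by rewrite ltNge uFy.
Qed.

Lemma quantile_fin_num X u : 0 < u < 1 -> quantile X u \is a fin_num.
Proof.
move=> /andP[u0 u1].
have /(cvg_cdfy1 X)[M [_ HM]] : nbhs (1%E : \bar R) [set y | (u%:E < y)%E].
  apply: open_nbhs_nbhs; split.
    exact: open_ereal_gt_ereal.
  by rewrite /= lte_fin.
have /(cvg_cdfNy0 X)[N [_ HN]] : nbhs (0%E : \bar R) [set y | (y < u%:E)%E].
  apply: open_nbhs_nbhs; split.
    exact: open_ereal_lt_ereal.
  by rewrite /= lte_fin.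
have lM : (quantile X u <= (M + 1)%:E)%E.
  by rewrite quantile_le// ltW// HM// ltrDl.
have lN : ((N - 1)%:E < quantile X u)%E.
  by rewrite ltNge quantile_le// -ltNge HN// gtrDl ltrN10.
by rewrite fin_numE; apply/andP; split; [case: quantile lN|case: quantile lM].
Qed.

(** The endpoints are cut off because the quantile may be infinite there; they
    are negligible for every integral in use. *)
Definition qfun X : R -> R := (fine \o quantile X) \_ `]0, 1[.

Lemma qfunE X u : 0 < u < 1 -> (qfun X u)%:E = quantile X u.
Proof.
by move=> u01; rewrite /qfun patchE mem_set//= fineK// quantile_fin_num.
Qed.

Lemma qfun_gt X u x : 0 < u < 1 -> (x < qfun X u) = (fine (cdf X x) < u).
Proof.
move=> u01; rewrite -lte_fin qfunE// ltNge quantile_le; last by case/andP: u01.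
by rewrite -ltNge -lte_fin fineK// fin_num_measure.
Qed.

Lemma cdf_itv01 X x : 0 <= fine (cdf X x) <= 1.
Proof.
rewrite fine_ge0 ?cdf_ge0//= -lee_fin fineK ?cdf_le1//.
exact: fin_num_measure.
Qed.

Lemma qfun_preimage X x :
  `]0, 1[ `&` qfun X @^-1` `]x, +oo[ = `]fine (cdf X x), 1[%classic.
Proof.
have /andP[c0 c1] := cdf_itv01 X x.
apply/seteqP; split => u /=; rewrite !in_itv/= ?andbT.
  by move=> [u01]; rewrite qfun_gt// => ->; case/andP: u01.
move=> /andP[cu u1]; have u01 : 0 < u < 1 by rewrite u1 (le_lt_trans c0).
by rewrite qfun_gt.
Qed.

Lemma measurable_qfun X : measurable_fun [set: measurableTypeR R]
  (qfun X : measurableTypeR R -> R).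
Proof.
apply: (measurable_restrictT _ _).1 => //.
apply: (measurability (@RGenOInfty.G R)) => [|/= _ [_] [r] -> <-].
  exact: RGenOInfty.measurableE.
rewrite [X in measurable X](_ : _ = `]fine (cdf X r), 1[%classic)//.
rewrite -qfun_preimage; apply/seteqP; split=> u /= [u01 h]; split => //.
  by rewrite /qfun patchE mem_set.
by move: h; rewrite /qfun patchE mem_set.
Qed.

End quantile_function.

(** * Minima as images of beta distributions *)

Section beta_tail.
Context {R : realType}.
Notation mu := (@lebesgue_measure R).

Lemma beta_pdf1E k (u : R) : 0 <= u <= 1 ->
  beta_pdf 1 k.+1 u = k.+1%:R * (1 - u) ^+ k.
Proof.
move=> u01; rewrite /beta_pdf beta_fun1Sn invrK patchE mem_set//.
by rewrite /= XMonemX0n mulrC.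
Qed.

Lemma beta_prob1_tail k (a : R) : 0 <= a <= 1 ->
  beta_prob 1 k.+1 `]a, 1[ = ((1 - a) ^+ k.+1)%:E.
Proof.
move=> /andP[a0 a1].
rewrite -integral_beta_pdf//.
have mb b1 b2 : measurable_fun [set` Interval (BSide b1 a) (BSide b2 1)]
    (EFin \o beta_pdf 1 k.+1).
  by apply/measurable_EFinP/measurable_funTS; exact: measurable_beta_pdf.
rewrite integral_itv_bndo_bndc// integral_itv_obnd_cbnd//.
have iM : mu.-integrable `[a, 1] (EFin \o (fun u => (1 - u) ^+ k)).
  apply: integrableS (integrable_onemXn k) => //.
  by apply: subset_itvr; rewrite bnd_simp.
transitivity (k.+1%:R * \int[mu]_(u in `[a, 1]) ((1 - u) ^+ k))%:E.
  rewrite -RintegralZl// /Rintegral fineK; last first.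
    by apply: integrable_fin_num => //; exact: (integrableZl _ _ iM).
  apply: eq_integral => u; rewrite inE/= in_itv/= => /andP[au u1].
  by rewrite beta_pdf1E// u1 (le_trans a0).
by rewrite Rintegral_onemXn_itv// mulrC divfK.
Qed.

(** The quantile function as a random variable under the law of the minimum of
    k + 1 independent uniform variables. *)
Definition beta_qRV {d} {T : measurableType d} {P : probability T R}
    (X : {RV P >-> R}) k : {RV (beta_prob 1 k.+1) >-> R} :=
  @mfun_Sub _ _ (measurableTypeR R) R (qfun X) (mem_set (measurable_qfun X)).

(** By the Galois connection the event is, within ]0, 1[, the interval
    ]F_X(x), 1[; the right-hand side is the tail of the minimum of k + 1
    independent copies of X. *)
Lemma ccdf_beta_qRV {d} {T : measurableType d} {P : probability T R}
    (X : {RV P >-> R}) k x : ccdf (beta_qRV X k) x = (\prod_(i < k.+1) ccdf X x)%E.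
Proof.
pose B : probability (measurableTypeR R) R := beta_prob 1 k.+1.
have Btail (a : R) : 0 <= a <= 1 -> B `]a, 1[%classic = ((1 - a) ^+ k.+1)%:E.
  exact: beta_prob1_tail.
pose U := qfun X @^-1` `]x, +oo[.
have mU : measurable (U : set (measurableTypeR R)).
  by rewrite -[U]setTI; exact: measurable_qfun.
have mI : measurable (`]0, 1[%classic : set (measurableTypeR R)) by [].
have I0 : B (~` `]0, 1[%classic) = 0%E.
  rewrite probability_setC// Btail ?lexx ?ler01// subr0 expr1n.
  by rewrite subee.
transitivity (B (`]0, 1[%classic `&` U)).
  rewrite [LHS](_ : _ = B U)//.
  rewrite -[in LHS](setIT U) -(setUv `]0, 1[%classic) setIUr measureU//.
  - rewrite [X in (_ + X)%E](_ : _ = 0%E) ?adde0 1?setIC//.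
    apply/eqP; rewrite eq_le measure_ge0 andbT -I0 le_measure//.
    + by rewrite inE; apply: measurableI => //; exact: measurableC.
    + by rewrite inE; exact: measurableC.
  - exact: measurableI.
  - by apply: measurableI => //; exact: measurableC.
  - by rewrite setIACA setICr setI0.
rewrite qfun_preimage Btail ?cdf_itv01//.
rewrite ccdf_1_cdf.
have -> : (1 - cdf X x)%E = (1 - fine (cdf X x))%:E.
  by rewrite EFinB fineK// fin_num_measure.
by rewrite prodEFin prodr_const card_ord.
Qed.

End beta_tail.

(** * Order statistics and inverse distribution functions as iterated integrals *)

Section order_means.
Context {R : realType} {d : measure_display} {T : measurableType d}.
Context {P : probability T R}.
Implicit Types X : {RV P >-> R}.
Notation mu := (@lebesgue_measure R).

Lemma eq_ccdf_integrable {d1} {T1 : measurableType d1} {P1 : probability T1 R}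
    {X1 : {RV P1 >-> R}} {d2} {T2 : measurableType d2} {P2 : probability T2 R}
    {X2 : {RV P2 >-> R}} : (forall x, ccdf X1 x = ccdf X2 x) ->
  P1.-integrable setT (EFin \o X1) ->
  P2.-integrable setT (EFin \o X2) /\
  (\int[P1]_w (X1 w)%:E = \int[P2]_w (X2 w)%:E)%E.
Proof.
move=> cc iX1; have D := eq_ccdf_distribution cc.
have iX2 : P2.-integrable setT (EFin \o X2).
  have /integrableP[_ Xoo] := iX1.
  apply/integrableP; split; first exact/measurable_EFinP.
  apply: le_lt_trans Xoo.
  have mabs : measurable_fun [set: R] (fun y : R => `|y%:E|%E).
    exact: measurableT_comp.
  have := ge0_integral_distribution X2 mabs (fun=> abse_ge0 _).
  have := ge0_integral_distribution X1 mabs (fun=> abse_ge0 _).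
  rewrite /comp/= => <- <-.
  by rewrite (eq_measure_integral (distribution P1 X1))// => A mA _; exact/esym/D.
split=> //.
have mE : measurable_fun [set: R] (@EFin R) by exact/measurable_EFinP.
rewrite -(integral_distribution mE iX1) -(integral_distribution mE iX2).
by apply: eq_measure_integral => A mA _; exact: D.
Qed.

(** The minimum of k + 1 independent copies of X has the law of
    [beta_qRV X k], as their tails agree; integrability carries over as well. *)
Lemma min_order_mean_beta X k : (X : T -> R) \in Lfun P 1%E ->
  (beta_prob 1 k.+1).-integrable setT (EFin \o beta_qRV X k) /\
  (\int[beta_prob 1 k.+1]_u (qfun X u)%:E = (min_order_mean X k.+1)%:E)%E.
Proof.
move=> XL; have [d' [T' [Q [Z iidZ]]]] := iid_copies_exist X k.+1.
pose M : {RV Q >-> R} := mfun_Sub (mem_set (min_of_measurable Z k.+1)).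
have ML : Q.-integrable setT (EFin \o M).
  exact/Lfun1_integrable/(min_of_L1 (ltn0Sn k) XL iidZ).
have cc x : ccdf M x = ccdf (beta_qRV X k) x.
  by rewrite (ccdf_min_of (ltn0Sn k) _ iidZ)// ccdf_beta_qRV.
have [iq E] := eq_ccdf_integrable cc ML.
split=> //.
by rewrite -(min_order_meanE (ltn0Sn k) XL iidZ) (expectation_def M) E.
Qed.

(** The case k = 0 of the preceding lemma, the beta law being then uniform. *)
Lemma integrable_qfun X : (X : T -> R) \in Lfun P 1%E ->
  mu.-integrable `[0, 1] (EFin \o qfun X).
Proof.
move=> XL; have [/integrableP[_ foo] _] := min_order_mean_beta X 0 XL.
apply/integrableP; split.
  by apply/measurable_EFinP/measurable_funTS; exact: measurable_qfun.
move: foo; rewrite beta_prob_uniform integral_uniform//.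
  by rewrite subr0 invr1 mul1e.
by apply: measurableT_comp => //; apply/measurable_EFinP; exact: measurable_qfun.
Qed.

Lemma min_order_meanE_qfun X k : (X : T -> R) \in Lfun P 1%E ->
  min_order_mean X k.+1 =
  k.+1%:R * \int[mu]_(u in `[0, 1]) ((1 - u) ^+ k * qfun X u).
Proof.
move=> XL; have [/integrableP[mq foo] E] := min_order_mean_beta X k XL.
apply: EFin_inj; rewrite -E integral_beta_prob//.
have iq := integrable_onemXnM _ k (integrable_qfun X XL).
rewrite -RintegralZl// /Rintegral fineK; last first.
  by apply: integrable_fin_num => //; exact: (integrableZl _ _ iq).
rewrite [RHS]integral_mkcond; apply: eq_integral => u _.
rewrite patchE; case: ifPn => u01; last first.
  by rewrite /beta_pdf patchE (negbTE u01) mul0r mule0.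
move: u01; rewrite inE/= in_itv/= => u01.
by rewrite -EFinM beta_pdf1E// mulrC mulrA.
Qed.

Lemma min_order_mean_iterint X k : (X : T -> R) \in Lfun P 1%E ->
  min_order_mean X k.+1 = (k.+1`!)%:R * iterint (qfun X) k.+1 1.
Proof.
move=> XL; rewrite min_order_meanE_qfun// -iterint1; last exact: integrable_qfun.
by rewrite mulrA -natrM -factS.
Qed.

(** The first integration removes the possible infinite values at the
    endpoints, which is why real values start at index 2. *)
Lemma iter_quantileE X m p : (X : T -> R) \in Lfun P 1%E -> 0 <= p <= 1 ->
  iter_quantile X m.+2 p = (iterint (qfun X) m.+1 p)%:E.
Proof.
move=> XL; have iq := integrable_qfun X XL.
elim: m p => [|m IH] p /andP[p0 p1].
  rewrite [RHS]/= /Rintegral fineK; last first.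
    apply: integrable_fin_num => //; exact: (integrable_iterintS _ 0 _ iq).
  have mq : measurable_fun `]0, p[ (EFin \o qfun X).
    by apply/measurable_EFinP/measurable_funTS; exact: measurable_qfun.
  have qE : {in `]0, p[%classic, EFin \o qfun X =1 quantile X}.
    move=> u; rewrite inE/= in_itv/= => /andP[u0 up].
    by rewrite /= qfunE// u0 (lt_le_trans up).
  have mQ : measurable_fun `]0, p[ (quantile X) by exact: eq_measurable_fun mq.
  rewrite [LHS]/= integral_itv_bndoo// [RHS]integral_itv_bndoo//.
  by apply: eq_integral => u /qE <-.
transitivity (\int[mu]_(u in `[0%R, p]) (iterint (qfun X) m.+1 u)%:E)%E.
  apply: eq_integral => u; rewrite inE/= in_itv/= => /andP[u0 up].
  by rewrite -IH// u0 (le_trans up).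
rewrite [RHS]/= /Rintegral fineK//; apply: integrable_fin_num => //.
exact: (integrable_iterintS _ m.+1 _ iq).
Qed.

End order_means.

(** * The ordering of the means of minima *)

Theorem theorem3p4 (R : realType) (d : measure_display) (T : measurableType d)
    (P : probability T R) (P_atomless : atomless P)
    (n : nat) (n_gt2 : (2 < n)%N)
    (X Y : {RV P >-> R})
    (X_L1 : (X : T -> R) \in Lfun P 1%E) (Y_L1 : (Y : T -> R) \in Lfun P 1%E)
    (XY : inverse_dominated n X Y)
    (k : nat) (k_lt : (k < n - 2)%N)
    (mu_eq : forall j : nat, (j <= k)%N ->
       min_order_mean X (n - 1 - j) = min_order_mean Y (n - 1 - j)) :
  (-1) ^+ k.+1 * min_order_mean X (n - 2 - k)
    <= (-1) ^+ k.+1 * min_order_mean Y (n - 2 - k).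
Proof.
have iX := integrable_qfun X X_L1; have iY := integrable_qfun Y Y_L1.
pose g := qfun Y \- qfun X.
have ig : lebesgue_measure.-integrable `[0, 1] (EFin \o g).
  exact: (integrableB _ iY iX).
(* n - 2 - k = m + 1 is positive, as [iterint_sign] requires. *)
have [m nE] : exists m, n = (m.+1 + k.+1).+1.
  exists (n - 2 - k).-1; lia.
have muE i : (0 < i)%N ->
    min_order_mean Y i - min_order_mean X i = (i`!)%:R * iterint g i 1.
  case: i => // i _; rewrite !min_order_mean_iterint//.
  by rewrite iterintB// mulrBr.
have -> : (n - 2 - k = m.+1)%N by lia.
rewrite -subr_ge0 -mulrBr muE// mulrCA mulr_ge0//.
apply: iterint_sign => // [i /andP[mi im]|p /andP[p0 p1]].
  have i0 : (0 < i)%N by lia.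
  have := mu_eq (n - 1 - i)%N _; rewrite (_ : n - 1 - (n - 1 - i) = i)%N; last lia.
  move=> /(_ ltac:(lia)) /eqP; rewrite eq_sym -subr_eq0 muE// mulf_eq0.
  by rewrite pnatr_eq0 -[_ == 0]negbK -lt0n fact_gt0/= => /eqP.
have := XY p; rewrite nE p0 p1 => /(_ isT).
rewrite addSn !iter_quantileE ?(ltW p0) ?(ltW p1)// lee_fin -subr_ge0.
by rewrite -iterintB// ltW.
Qed.
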